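(* Let $(\Omega,\mathcal{F},\mathbb{P})$ be a probability space, let $\mathcal{X}\subseteq\mathbb{L}^0_+$, and for each $n\in\mathbb{N}$ define $$\mathcal{O}^{\mathcal{X}}_n:=\{Y\in\mathbb{L}^0_+ : Y\le Z \text{ for some } Z\in\mathrm{conv}\{(X-n)_+ : X\in\mathcal{X}\}\}.$$ Then the following are equivalent: (1) $\bigcap_{n\in\mathbb{N}}\mathcal{O}^{\mathcal{X}}_n=\{0\}$; (2) there exists a probability $\mathbb{Q}$ equivalent to $\mathbb{P}$ such that $\mathcal{X}$ is uniformly $\mathbb{Q}$-integrable, i.e. $\lim_{n\to\infty}\sup_{X\in\mathcal{X}}\mathbb{E}_{\mathbb{Q}}[X\mathbb{I}_{\{X>n\}}]=0$.
   Context: $\mathbb{L}^0$ is the space of (equivalence classes modulo $\mathbb{P}$-null sets of) real-valued random variables, $\mathbb{L}^0_+$ its nonnegative elements; inequalities are $\mathbb{P}$-a.s. $\mathrm{conv}$ denotes the convex hull (finite convex combinations), and $x_+=\max\{x,0\}$. *)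

(* Defs.v *)
From HB Require Import structures.
From mathcomp Require Import all_boot all_order all_algebra.
From mathcomp Require Import all_classical all_reals all_analysis.
Set Implicit Arguments. Unset Strict Implicit. Unset Printing Implicit Defensive.
Import Order.TTheory GRing.Theory Num.Theory.
Local Open Scope classical_set_scope.
Local Open Scope ring_scope.

Definition conv_hull (R : realType) (T : Type) (S : set (T -> R)) : set (T -> R) :=
  [set Z | exists (k : nat) (c : 'I_k -> R) (f : 'I_k -> T -> R),
     [/\ (forall i, 0 <= c i), \sum_(i < k) c i = 1, (forall i, S (f i))
       & Z = (fun x => \sum_(i < k) c i * f i x)]].

(* L^0_+ membership of a representative: measurable and P-a.s. nonnegative *)
Definition L0plus (d : measure_display) (T : measurableType d) (R : realType)
  (P : probability T R) (Y : T -> R) : Prop :=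
  measurable_fun setT Y /\ {ae P, forall x, 0 <= Y x}.

Definition O_n (d : measure_display) (T : measurableType d) (R : realType)
  (P : probability T R) (X : set (T -> R)) (n : nat) : set (T -> R) :=
  [set Y | L0plus P Y /\
     exists Z, conv_hull [set (fun x => Num.max (Xi x - n%:R) 0) | Xi in X] Z
               /\ {ae P, forall x, Y x <= Z x}].

Definition equiv_prob (d : measure_display) (T : measurableType d) (R : realType)
  (P Q : probability T R) : Prop :=
  forall A, measurable A -> (Q A = 0%E <-> P A = 0%E).

(* Main.v *)
(* For (2) => (1), if Y <= Z with Z in conv (X - n)_+ then E_Q[Y] is at most
   sup_X E_Q[X 1_{X > n}].

   For (1) => (2), minimize E(1 - y)^2 over the elements y <= 1 of the class
   O_n.  Near-minimizers y_k for levels n_k whose minimal values are almost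
   their supremum satisfy E|y_{k+1} - y_k| <= 4 * 2^-k by the parallelogram
   law.  Hence inf_{k >= m} y_k, which lies in every O_n and so vanishes, has
   almost the same mean as y_m and as sup_{k >= m} y_k: the weights
   h_m = 1 - sup_{k >= m} y_k increase to 1.  The first-order condition at y_k
   bounds E[(1 - y_k) z], hence E[h_m z], by a multiple of 2^-k for all z in
   O_{n_k} with z <= n_{k+1}; the precision of y_k is chosen after n_{k+1}.
   Cutting (X - n_l)_+ into the layers between consecutive n_k gives
   E[h_m (X - n_l)_+] <= 18 * 2^-l for l >= m, uniformly in X, and Q is given
   by a density proportional to sup_m a_m h_m with a_m small enough. *)
Require Import Defs.
From HB Require Import structures.
From mathcomp Require Import all_boot all_order all_algebra.
From mathcomp Require Import all_classical all_reals all_analysis.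
From mathcomp Require Import measurable_realfun ring lra.
Import Order.TTheory GRing.Theory Num.Theory.
Local Open Scope classical_set_scope.
Local Open Scope ring_scope.

(** * Expectations of bounded measurable functions *)

Section BoundedMeasurable.
Context {d : measure_display} {T : measurableType d} {R : realType}
  (P : probability T R).
Implicit Types f g h : T -> R.

Definition bounded_measurable f :=
  measurable_fun setT f /\ exists M, forall x, `|f x| <= M.

Lemma bounded_measurable_cst (c : R) : bounded_measurable (fun=> c).
Proof. by split; [exact: measurable_cst|exists `|c|]. Qed.

Lemma bounded_measurableD f g : bounded_measurable f -> bounded_measurable g ->
  bounded_measurable (fun x => f x + g x).
Proof.
move=> [mf [M hM]] [mg [N hN]]; split; first exact: measurable_funD.
by exists (M + N) => x; rewrite (le_trans (ler_normD _ _))// lerD.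
Qed.

Lemma bounded_measurableM f g : bounded_measurable f -> bounded_measurable g ->
  bounded_measurable (fun x => f x * g x).
Proof.
move=> [mf [M hM]] [mg [N hN]]; split; first exact: measurable_funM.
by exists (M * N) => x; rewrite normrM ler_pM.
Qed.

Lemma bounded_measurableZ c f : bounded_measurable f ->
  bounded_measurable (fun x => c * f x).
Proof. exact/bounded_measurableM/bounded_measurable_cst. Qed.

Lemma bounded_measurableB f g : bounded_measurable f -> bounded_measurable g ->
  bounded_measurable (fun x => f x - g x).
Proof.
move=> bf /(bounded_measurableZ (-1)) bg.
rewrite (_ : (fun x => f x - g x) = (fun x => f x + -1 * g x)).
  exact: bounded_measurableD.
by apply/funext => x; rewrite mulN1r.
Qed.

Lemma bounded_measurable_norm f : bounded_measurable f ->
  bounded_measurable (fun x => `|f x|).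
Proof.
move=> [mf [M hM]]; split; first exact: measurableT_comp.
by exists M => x; rewrite normr_id.
Qed.

Lemma bounded_measurable_range f a b : measurable_fun setT f ->
  (forall x, a <= f x <= b) -> bounded_measurable f.
Proof.
move=> mf hf; split=> //; exists (`|a| + `|b|) => x.
have /andP[ax xb] := hf x.
have ha := lerNnormlW (lexx `|a|).
have hb := ler_norm b.
rewrite ler_norml; apply/andP; split.
  by rewrite (le_trans _ ax)// opprD ler_wnDr// oppr_le0.
by rewrite (le_trans xb)// (le_trans hb)// ler_wpDl.
Qed.

Lemma bounded_measurable_integrable f : bounded_measurable f ->
  P.-integrable setT (EFin \o f).
Proof.
move=> [mf [M hM]]; apply: measurable_bounded_integrable => //.
  by rewrite [ltLHS]probability_setT ltry.
by exists M; split; [exact: num_real|move=> N MN x _; exact: le_trans (hM x) (ltW MN)].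
Qed.

Definition mean f : R := \int[P]_x f x.

Lemma EFin_mean f : bounded_measurable f ->
  (mean f)%:E = (\int[P]_x (f x)%:E)%E.
Proof.
move=> bf; rewrite /mean /Rintegral fineK//.
exact: integrable_fin_num (bounded_measurable_integrable _ bf).
Qed.

Lemma mean_cst c : mean (fun=> c) = c.
Proof. by rewrite /mean Rintegral_cst// [X in fine X]probability_setT mulr1. Qed.

Lemma meanD f g : bounded_measurable f -> bounded_measurable g ->
  mean (fun x => f x + g x) = mean f + mean g.
Proof. by move=> bf bg; rewrite /mean RintegralD//; exact: bounded_measurable_integrable. Qed.

Lemma meanZ c f : bounded_measurable f -> mean (fun x => c * f x) = c * mean f.
Proof. by move=> bf; rewrite /mean RintegralZl//; exact: bounded_measurable_integrable. Qed.

Lemma meanB f g : bounded_measurable f -> bounded_measurable g ->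
  mean (fun x => f x - g x) = mean f - mean g.
Proof. by move=> bf bg; rewrite /mean RintegralB//; exact: bounded_measurable_integrable. Qed.

Lemma le_mean f g : bounded_measurable f -> bounded_measurable g ->
  (forall x, f x <= g x) -> mean f <= mean g.
Proof.
move=> bf bg fg; rewrite /mean le_Rintegral//; exact: bounded_measurable_integrable.
Qed.

Lemma mean_ge0 f : (forall x, 0 <= f x) -> 0 <= mean f.
Proof. by move=> f0; apply: Rintegral_ge0. Qed.

Lemma eq_mean f g : (forall x, f x = g x) -> mean f = mean g.
Proof. by move=> fg; congr mean; apply/funext. Qed.

Lemma mean_ae0 f : bounded_measurable f -> {ae P, forall x, f x = 0} -> mean f = 0.
Proof.
move=> bf f0; apply/EFin_inj; rewrite EFin_mean//.
rewrite (ae_eq_integral (cst 0%E)) ?integral0//.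
- exact/measurable_EFinP/bf.1.
- by apply: filterS f0 => x /= -> .
Qed.

End BoundedMeasurable.
#[global] Hint Resolve bounded_measurable_cst : core.

(** * Geometric series of ratio 1/2 in the extended reals *)

Lemma nneseries_le {R : realType} (u : nat -> \bar R) (b : \bar R) :
  (forall n, 0 <= u n)%E -> (forall N, \sum_(0 <= j < N) u j <= b)%E ->
  (\sum_(j <oo) u j <= b)%E.
Proof.
move=> u0 ub; apply: lime_le; first exact: is_cvg_nneseries.
by apply: nearW => N; exact: ub.
Qed.

Lemma sum_half_geometric {R : realType} (m N : nat) :
  \sum_(0 <= j < N) 2^-1 ^+ (m + j) = 2 * (2^-1 ^+ m - 2^-1 ^+ (m + N)) :> R.
Proof.
elim: N => [|N IH]; first by rewrite big_geq// addn0 subrr mulr0.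
by rewrite big_nat_recr//= IH addnS exprS; field.
Qed.

Lemma nneseries_half_geometric_le {R : realType} (c : R) (m : nat)
    (u : nat -> \bar R) : 0 <= c -> (forall j, 0 <= u j)%E ->
  (forall j, u j <= (c * 2^-1 ^+ (m + j))%:E)%E ->
  (\sum_(j <oo) u j <= (c * (2 * 2^-1 ^+ m))%:E)%E.
Proof.
move=> c0 u0 uc; apply: nneseries_le => // N.
have h : (\sum_(0 <= j < N) u j <= \sum_(0 <= j < N) (c * 2^-1 ^+ (m + j))%:E)%E.
  exact: lee_sum.
apply: (le_trans h); rewrite sumEFin lee_fin -mulr_sumr ler_wpM2l//.
by rewrite sum_half_geometric ler_wpM2l// lerBlDr lerDl exprn_ge0// invr_ge0.
Qed.

(** * Tail suprema and infima of a sequence with geometrically small L1 increments *)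

Section RapidSequence.
Context {d : measure_display} {T : measurableType d} {R : realType}
  (P : probability T R).
Variables (y : nat -> T -> R) (c : R).
Hypothesis my : forall k, measurable_fun setT (y k).
Hypothesis y01 : forall k x, 0 <= y k x <= 1.
Hypothesis c0 : 0 <= c.
Hypothesis dy : forall k, mean P (fun x => `|y k.+1 x - y k x|) <= c * 2^-1 ^+ k.

Definition upper_env m x := sups (y^~ x) m.
Definition lower_env m x := infs (y^~ x) m.

Lemma range_has_ubound x : has_ubound (range (y^~ x)).
Proof. by exists 1 => _ [k _ <-]; have /andP[] := y01 k x. Qed.

Lemma range_has_lbound x : has_lbound (range (y^~ x)).
Proof. by exists 0 => _ [k _ <-]; have /andP[] := y01 k x. Qed.

Lemma measurable_upper_env m : measurable_fun setT (upper_env m).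
Proof. by apply: measurable_fun_sups => // t _; exact: range_has_ubound. Qed.

Lemma measurable_lower_env m : measurable_fun setT (lower_env m).
Proof. by apply: measurable_fun_infs => // t _; exact: range_has_lbound. Qed.

Lemma le_upper_env m k x : (m <= k)%N -> y k x <= upper_env m x.
Proof.
move=> mk; apply: ub_le_sup; last by exists k.
exact/has_ubound_sdrop/range_has_ubound.
Qed.

Lemma ge_lower_env m k x : (m <= k)%N -> lower_env m x <= y k x.
Proof.
move=> mk; apply: ge_inf; last by exists k.
exact/has_lbound_sdrop/range_has_lbound.
Qed.

Lemma upper_env_le m x b : (forall k, (m <= k)%N -> y k x <= b) -> upper_env m x <= b.
Proof.
move=> h; apply: ge_sup; first by exists (y m x), m => /=.
by move=> _ [k /= mk <-]; exact: h.
Qed.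

Lemma lower_env_ge m x b : (forall k, (m <= k)%N -> b <= y k x) -> b <= lower_env m x.
Proof.
move=> h; apply: lb_le_inf; first by exists (y m x), m => /=.
by move=> _ [k /= mk <-]; exact: h.
Qed.

Lemma upper_env01 m x : 0 <= upper_env m x <= 1.
Proof.
have /andP[y0 _] := y01 m x.
rewrite (le_trans y0 (le_upper_env _ _ x (leqnn m)))/=.
by apply: upper_env_le => k _; have /andP[] := y01 k x.
Qed.

Lemma lower_env01 m x : 0 <= lower_env m x <= 1.
Proof.
have /andP[_ y1] := y01 m x.
rewrite (le_trans (ge_lower_env _ _ x (leqnn m)) y1) andbT.
by apply: lower_env_ge => k _; have /andP[] := y01 k x.
Qed.

Lemma bounded_measurable_y k : bounded_measurable (y k).
Proof. exact: bounded_measurable_range (my k) (y01 k). Qed.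

Lemma bounded_measurable_upper_env m : bounded_measurable (upper_env m).
Proof. exact: bounded_measurable_range (measurable_upper_env m) (upper_env01 m). Qed.

Lemma bounded_measurable_lower_env m : bounded_measurable (lower_env m).
Proof. exact: bounded_measurable_range (measurable_lower_env m) (lower_env01 m). Qed.

Let incr m j x : R := `|y (m + j).+1 x - y (m + j) x|.

(** Telescoping and the triangle inequality. The series is extended-real because it may diverge at
    some [x]. *)
Lemma dist_le_incr m k x : (`|y (m + k) x - y m x|%:E <= \sum_(j <oo) (incr m j x)%:E)%E.
Proof.
apply: (@le_trans _ _ (\sum_(0 <= j < k) (incr m j x)%:E)%E); last first.
  by apply: nneseries_lim_ge => j _ _; rewrite lee_fin normr_ge0.
rewrite sumEFin lee_fin; elim: k => [|k IH].
  by rewrite addn0 subrr normr0 big_geq.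
rewrite big_nat_recr//= addnS (le_trans _ (lerD IH (lexx (incr m k x))))//.
have -> : y (m + k).+1 x - y m x = (y (m + k) x - y m x) + (y (m + k).+1 x - y (m + k) x).
  by ring.
exact: ler_normD.
Qed.

Lemma bounded_measurable_incr m j : bounded_measurable (incr m j).
Proof. exact/bounded_measurable_norm/bounded_measurableB/bounded_measurable_y/bounded_measurable_y. Qed.

Lemma integral_incr_le m :
  (\int[P]_x (\sum_(j <oo) (incr m j x)%:E) <= (c * (2 * 2^-1 ^+ m))%:E)%E.
Proof.
rewrite integral_nneseries//=.
- apply: nneseries_half_geometric_le => // j.
    by apply: integral_ge0 => x _; rewrite lee_fin normr_ge0.
  rewrite -EFin_mean; last exact: bounded_measurable_incr.
  by rewrite lee_fin; exact: dy.
- by move=> n; apply/measurable_EFinP; have [] := bounded_measurable_incr m n.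
- by move=> n x _; rewrite lee_fin normr_ge0.
Qed.

(** The last hypothesis expresses that [f] is at most the supremum over [k] of the distances from
    [y (m + k)] to [y m]; in this form it covers both envelopes. *)
Lemma mean_le_of_dist m (f : T -> R) : bounded_measurable f -> (forall x, 0 <= f x) ->
  (forall x b, (forall k, `|y (m + k) x - y m x| <= b) -> f x <= b) ->
  mean P f <= c * (2 * 2^-1 ^+ m).
Proof.
move=> bf f0 hf; rewrite -lee_fin EFin_mean// (le_trans _ (integral_incr_le m))//.
apply: ge0_le_integral => //=.
- by move=> x _; rewrite lee_fin.
- by apply/measurable_EFinP; exact: bf.1.
- apply: ge0_emeasurable_sum; first by move=> j x _ _; rewrite lee_fin normr_ge0.
  by move=> j _; apply/measurable_EFinP; have [] := bounded_measurable_incr m j.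
move=> x _; move: (fun k => dist_le_incr m k x).
have : (0 <= \sum_(j <oo) (incr m j x)%:E)%E.
  by apply: nneseries_ge0 => j _ _; rewrite lee_fin normr_ge0.
(* Where the series is finite its value serves as [b]; where it is infinite the bound is trivial. *)
case: (\sum_(j <oo) (incr m j x)%:E)%E => [b _ h||//]; last by move=> *; rewrite leey.
by rewrite lee_fin; apply: hf => k; rewrite -lee_fin.
Qed.

Lemma mean_upper_env_le m : mean P (upper_env m) <= mean P (y m) + c * (2 * 2^-1 ^+ m).
Proof.
rewrite -lerBlDl -meanB; last 2 first.
  exact: bounded_measurable_upper_env.
  exact: bounded_measurable_y.
apply: mean_le_of_dist.
- exact/bounded_measurableB/bounded_measurable_y/bounded_measurable_upper_env.
- by move=> x; rewrite subr_ge0 le_upper_env.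
move=> x b hb; rewrite lerBlDr; apply: upper_env_le => k mk.
by have := hb (k - m)%N; rewrite subnKC// -lerBlDr; exact/le_trans/ler_norm.
Qed.

Lemma mean_lower_env_ge m : mean P (y m) <= mean P (lower_env m) + c * (2 * 2^-1 ^+ m).
Proof.
rewrite -lerBlDl -meanB; last 2 first.
  exact: bounded_measurable_y.
  exact: bounded_measurable_lower_env.
apply: mean_le_of_dist.
- exact/bounded_measurableB/bounded_measurable_lower_env/bounded_measurable_y.
- by move=> x; rewrite subr_ge0 ge_lower_env.
move=> x b hb; rewrite lerBlDr -lerBlDl; apply: lower_env_ge => k mk.
rewrite lerBlDl -lerBlDr.
by have := hb (k - m)%N; rewrite subnKC// distrC; exact/le_trans/ler_norm.
Qed.

End RapidSequence.

(** * Near-minimizers of the squared distance to 1 in decreasing convex solid classes *)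

Section NearMinimizers.
Context {d : measure_display} {T : measurableType d} {R : realType}
  (P : probability T R) (G : nat -> set (T -> R)).
Hypothesis measurable_G : forall n y, G n y -> measurable_fun setT y.
Hypothesis G_ge0 : forall n y, G n y -> forall x, 0 <= y x.
Hypothesis G_0 : forall n, G n (fun=> 0).
Hypothesis G_convex : forall n y z (t : R), G n y -> G n z -> 0 <= t <= 1 ->
  G n (fun x => (1 - t) * y x + t * z x).
Hypothesis G_anti : forall m n, (m <= n)%N -> G n `<=` G m.
Hypothesis G_solid : forall n (y z : T -> R), G n y -> measurable_fun setT z ->
  (forall x, 0 <= z x <= y x) -> G n z.
Hypothesis G_null : forall y, (forall n, G n y) -> {ae P, forall x, y x = 0}.

Definition sqdist1 (y : T -> R) := mean P (fun x => (1 - y x) ^+ 2).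

Definition G1 n := [set y | G n y /\ forall x, y x <= 1].

Definition min_sqdist1 n := inf (sqdist1 @` G1 n).

Lemma G1_range n y : G1 n y -> forall x, 0 <= y x <= 1.
Proof. by move=> [Gy y1] x; rewrite (G_ge0 _ _ Gy) y1. Qed.

Lemma bounded_measurable_G n y (M : R) : G n y -> (forall x, y x <= M) ->
  bounded_measurable y.
Proof.
move=> Gy yM; apply: (bounded_measurable_range _ 0 M) => [|x].
  exact: measurable_G Gy.
by rewrite yM (G_ge0 _ _ Gy).
Qed.

Lemma bounded_measurable_G1 n y : G1 n y -> bounded_measurable y.
Proof. by move=> [Gy y1]; exact: bounded_measurable_G Gy y1. Qed.

Lemma bounded_measurable_sq1 (y : T -> R) : bounded_measurable y ->
  bounded_measurable (fun x => (1 - y x) ^+ 2).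
Proof.
by move=> by_; apply: bounded_measurableM; exact: bounded_measurableB.
Qed.

Lemma sqdist1_ge0 y : 0 <= sqdist1 y.
Proof. by apply: mean_ge0 => x; exact: sqr_ge0. Qed.

Lemma G1_anti m n : (m <= n)%N -> G1 n `<=` G1 m.
Proof. by move=> mn y [/(G_anti _ _ mn)]. Qed.

Lemma G1_0 n : G1 n (fun=> 0).
Proof. by split. Qed.

Lemma min_sqdist1_le n y : G1 n y -> min_sqdist1 n <= sqdist1 y.
Proof.
move=> Gy; apply: ge_inf; last by exists y.
by exists 0 => _ [z _ <-]; exact: sqdist1_ge0.
Qed.

Lemma min_sqdist1_mono m n : (m <= n)%N -> min_sqdist1 m <= min_sqdist1 n.
Proof.
move=> mn; apply: lb_le_inf; first by exists (sqdist1 (fun=> 0)), (fun=> 0) => //; exact: G1_0.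
by move=> _ [z Gz <-]; exact/min_sqdist1_le/(G1_anti _ _ mn).
Qed.

Lemma min_sqdist1_le1 n : min_sqdist1 n <= 1.
Proof.
apply: (le_trans (min_sqdist1_le _ _ (G1_0 n))).
by rewrite /sqdist1 (eq_mean P _ (fun=> 1)) ?mean_cst// => x; rewrite subr0 expr1n.
Qed.

Lemma near_minimizer n (e : R) : 0 < e -> exists y, G1 n y /\ sqdist1 y <= min_sqdist1 n + e.
Proof.
move=> e0; have [|_ [y Gy <-] /ltW ye] := @inf_adherent R (sqdist1 @` G1 n) e e0.
  split; first by exists (sqdist1 (fun=> 0)), (fun=> 0) => //; exact: G1_0.
  by exists 0 => _ [z _ <-]; exact: sqdist1_ge0.
by exists y.
Qed.

(** The minimal values increase with the level and stay below 1, so any level whose value is within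
    [e] of their supremum works. *)
Lemma min_sqdist1_cauchy (e : R) : 0 < e -> exists N, forall n p, (N <= n)%N ->
  min_sqdist1 p <= min_sqdist1 n + e.
Proof.
move=> e0; have hs : has_sup (range min_sqdist1).
  split; first by exists (min_sqdist1 0%N), 0%N.
  by exists 1 => _ [n _ <-]; exact: min_sqdist1_le1.
have [_ [N _ <-] hN] := sup_adherent e0 hs.
exists N => n p Nn; rewrite -lerBlDr.
have hp : min_sqdist1 p <= sup (range min_sqdist1) by apply: (ub_le_sup hs.2); exists p.
by have := min_sqdist1_mono _ _ Nn; lra.
Qed.

(** The parallelogram law at the midpoint [w], which again lies in [G1 n], bounds the L2 distance;
    the inequality [u <= u^2 / (2 a) + a / 2] passes to the L1 distance. *)
Lemma mean_dist_near_minimizers n (y z : T -> R) (a : R) : G1 n y -> G1 n z -> 0 < a ->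
  mean P (fun x => `|z x - y x|) <=
    a^-1 * (sqdist1 y + sqdist1 z - 2 * min_sqdist1 n) + a / 2.
Proof.
move=> Gy Gz a0.
pose w x : R := (1 - 2^-1) * y x + 2^-1 * z x.
have Gw : G1 n w.
  have h2 : 0 <= (2^-1 : R) <= 1 by lra.
  split; first by apply: G_convex h2; [exact: Gy.1|exact: Gz.1].
  by move=> x; have := Gy.2 x; have := Gz.2 x; rewrite /w; lra.
have by_ := bounded_measurable_G1 _ _ Gy; have bz := bounded_measurable_G1 _ _ Gz.
have bw := bounded_measurable_G1 _ _ Gw.
have sy := bounded_measurable_sq1 _ by_; have sz := bounded_measurable_sq1 _ bz.
have sw := bounded_measurable_sq1 _ bw.
have syz := bounded_measurableD _ _ sy sz.
have sw2 := bounded_measurableZ 2 _ sw.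
have bd := bounded_measurableZ a^-1 _ (bounded_measurableB _ _ syz sw2).
apply: (@le_trans _ _ (a^-1 * (sqdist1 y + sqdist1 z - 2 * sqdist1 w) + a / 2)); last first.
  have ai : 0 <= a^-1 by rewrite invr_ge0 ltW.
  rewrite lerD2r ler_wpM2l// lerD2l lerN2 ler_wpM2l//.
  exact: min_sqdist1_le.
rewrite /sqdist1 -meanD// -meanZ// -meanB// -meanZ; last exact: bounded_measurableB.
rewrite -[a / 2 in leRHS](mean_cst P) -meanD//.
apply: le_mean => [||x].
- exact/bounded_measurable_norm/bounded_measurableB.
- exact: bounded_measurableD.
rewrite (_ : (1 - y x) ^+ 2 + _ - _ = (z x - y x) ^+ 2 / 2); last first.
  by rewrite /w; field.
rewrite -[(z x - y x) ^+ 2]real_normK ?num_real//.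
move: (normr_ge0 (z x - y x)); move: `|_| => u u0.
rewrite -subr_ge0 (_ : _ - u = (u - a) ^+ 2 / (2 * a)).
  by rewrite divr_ge0 ?sqr_ge0// mulr_ge0// ltW.
by field; rewrite gt_eqF.
Qed.

(* The first-order condition at an approximate minimizer y, tested along the
   segment from y to z with step t. *)
Lemma near_minimizer_first_order n (y z : T -> R) (t M w : R) : 0 <= M -> 0 < w <= 1 ->
  t = w / (M + 1) ^+ 2 -> G1 n y -> sqdist1 y <= min_sqdist1 n + t ^+ 2 ->
  G n z -> (forall x, z x <= M) ->
  mean P (fun x => (1 - y x) * z x) <= mean P y + w.
Proof.
move=> M0 /andP[w0 w1] tE Gy yt Gz zM.
have M1 : 1 <= (M + 1) ^+ 2 by rewrite exprn_ege1// lerDr.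
have t0 : 0 < t by rewrite tE divr_gt0// (lt_le_trans ltr01).
have tw : t * (M + 1) ^+ 2 = w by rewrite tE divfK// gt_eqF// (lt_le_trans ltr01).
have t1 : t <= 1 by rewrite (le_trans _ w1)// -tw ler_peMr// ltW.
pose u x : R := (1 - t) * y x + t * z x.
have Gu : G n u by apply: G_convex => //; [exact: Gy.1|rewrite (ltW t0) t1].
have by_ := bounded_measurable_G1 _ _ Gy; have bz := bounded_measurable_G _ _ _ Gz zM.
have bu : bounded_measurable u.
  by apply: bounded_measurableD; exact: bounded_measurableZ.
(* Truncation at 1 returns to [G1 n] by solidity and does not increase the distance to 1. *)
pose v x : R := Num.min (u x) 1.
have Gv : G1 n v.
  have mv : measurable_fun setT v by apply: measurable_minr => //; exact: bu.1.
  split; last by move=> x; rewrite /v ge_min lexx orbT.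
  apply: (G_solid _ _ _ Gu mv) => x.
  by rewrite /v ge_min lexx le_min (G_ge0 _ _ Gu) ler01.
have vu : sqdist1 v <= sqdist1 u.
  apply: le_mean; [exact/bounded_measurable_sq1/bounded_measurable_G1/Gv|exact: bounded_measurable_sq1|].
  by move=> x; rewrite /v; case: (leP (u x) 1) => // _; rewrite subrr expr0n/= sqr_ge0.
have by1 : bounded_measurable (fun x => (1 - y x) * z x).
  by apply: bounded_measurableM => //; exact: bounded_measurableB.
have sy := bounded_measurable_sq1 _ by_.
have b1 := bounded_measurableB _ _ by_ by1.
have b2 := bounded_measurableZ (2 * t) _ b1.
have b3 := bounded_measurableD _ _ sy b2.
(* Expand [(1 - u)^2] around [y], bound [(z - y)^2] by [(M + 1)^2] and drop the term [- 2 t y^2]. *)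
have uy : sqdist1 u <=
    sqdist1 y + 2 * t * (mean P y - mean P (fun x => (1 - y x) * z x)) + t ^+ 2 * (M + 1) ^+ 2.
  rewrite /sqdist1 -meanB// -meanZ// -meanD//.
  rewrite -[t ^+ 2 * _ in leRHS](mean_cst P) -meanD//.
  apply: le_mean => [||x]; [exact: bounded_measurable_sq1|exact: bounded_measurableD|].
  have /andP[y0 y1] := G1_range _ _ Gy x.
  have z0 := G_ge0 _ _ Gz x.
  have h1 : (z x - y x) ^+ 2 <= (M + 1) ^+ 2.
    by rewrite -subr_ge0 subr_sqr; have := zM x; move=> zMx; rewrite mulr_ge0//; lra.
  have h2 : t ^+ 2 * (z x - y x) ^+ 2 <= t ^+ 2 * (M + 1) ^+ 2 by rewrite ler_wpM2l// sqr_ge0.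
  have h3 : 0 <= t * y x ^+ 2 by rewrite mulr_ge0 ?sqr_ge0// ltW.
  rewrite /u; nra.
have h := min_sqdist1_le _ _ Gv.
(* Both errors, [t^2] from the near-minimality of [y] and the quadratic term, are at most [t * w];
   as the linear term carries [2 t], an error [w] remains. *)
rewrite -[_ <= _](ler_pM2l t0).
have : t ^+ 2 <= t ^+ 2 * (M + 1) ^+ 2 by rewrite ler_peMr// sqr_ge0.
rewrite (_ : t ^+ 2 * (M + 1) ^+ 2 = t * w) in uy *; last by rewrite -tw; ring.
lra.
Qed.

(** The levels depend only on the minimal values, so [n_ k.+1] is already known when the precision
    [t k ^+ 2] of [y k] is fixed. *)
Lemma rapid_near_minimizers : exists (n_ : nat -> nat) (y : nat -> T -> R),
  [/\ (forall k, (n_ k < n_ k.+1)%N), (forall k, G1 (n_ k) (y k)),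
   (forall k, mean P (fun x => `|y k.+1 x - y k x|) <= 4 * 2^-1 ^+ k) &
   (forall k z, G (n_ k) z -> (forall x, z x <= (n_ k.+1)%:R) ->
     mean P (fun x => (1 - y k x) * z x) <= mean P (y k) + 2^-1 ^+ k)].
Proof.
have half_gt0 k : 0 < 2^-1 ^+ k :> R by rewrite exprn_gt0.
have half_le1 k : 2^-1 ^+ k <= 1 :> R by rewrite exprn_ile1//; lra.
have /choice[N hN] k : exists N, forall n p, (N <= n)%N ->
    min_sqdist1 p <= min_sqdist1 n + (2^-1 ^+ k) ^+ 2.
  by apply: min_sqdist1_cauchy; rewrite exprn_gt0.
(* Partial sums make the levels strictly increasing and keep [n_ k] at least [N k]. *)
pose n_ k := (\sum_(0 <= j < k.+1) (N j).+1)%N.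
have n_S k : (n_ k < n_ k.+1)%N.
  by rewrite /n_ [in X in (_ < X)%N]big_nat_recr//= -addn1 leq_add2l.
have Nn k : (N k <= n_ k)%N by rewrite /n_ big_nat_recr//= -addSnnS leq_addl.
(* The step of the first-order condition for [M = n_ k.+1] and [w = 2^-k]. *)
pose t k : R := 2^-1 ^+ k / ((n_ k.+1)%:R + 1) ^+ 2.
have M1 k : 1 <= ((n_ k.+1)%:R + 1) ^+ 2 :> R by rewrite exprn_ege1// lerDr.
have t0 k : 0 < t k by rewrite divr_gt0// (lt_le_trans ltr01).
have tk k : t k <= 2^-1 ^+ k by rewrite ler_pdivrMr ?(lt_le_trans ltr01)// ler_peMr// ltW.
have /choice[y hy] k : exists y, G1 (n_ k) y /\ sqdist1 y <= min_sqdist1 (n_ k) + t k ^+ 2.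
  by apply: near_minimizer; rewrite exprn_gt0.
exists n_, y; split=> //.
- by move=> k; exact: (hy k).1.
- move=> k; have a0 := half_gt0 k.
  have h1 := mean_dist_near_minimizers _ _ _ _ (hy k).1
    (G1_anti _ _ (ltnW (n_S k)) _ (hy k.+1).1) a0.
  apply: (le_trans h1).
  have [_ hk] := hy k; have [_ hk1] := hy k.+1.
  have hn := hN k (n_ k) (n_ k.+1) (Nn k).
  have htk : t k ^+ 2 <= (2^-1 ^+ k) ^+ 2 by rewrite lerXn2r// nnegrE ltW.
  have htk1 : t k.+1 ^+ 2 <= (2^-1 ^+ k) ^+ 2.
    rewrite lerXn2r ?nnegrE ?(ltW (t0 _)) ?(ltW (half_gt0 _))// (le_trans (tk _))// exprS.
    by have := half_gt0 k; lra.
  (* With [a = 2^-k], the two precisions and the gap between the minimal values are at most [a^2]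
     each, whence [a^-1 * 3 a^2 + a / 2 <= 4 a]. *)
  apply: (@le_trans _ _ ((2^-1 ^+ k)^-1 * (4 * (2^-1 ^+ k) ^+ 2 - (2^-1 ^+ k) ^+ 2 + 0) + 2^-1 ^+ k / 2)).
    have ai : 0 <= (2^-1 ^+ k : R)^-1 by rewrite invr_ge0 ltW.
    rewrite lerD2r ler_wpM2l//; lra.
  move: (2^-1 ^+ k) a0 => a a0.
  rewrite (_ : _ + _ = a * (3 + 2^-1)); last by field; rewrite gt_eqF.
  lra.
- move=> k z Gz zM.
  apply: (near_minimizer_first_order _ _ _ (t k) (n_ k.+1)%:R _ _ _ _ (hy k).1 (hy k).2 Gz zM) => //.
  by rewrite half_gt0 half_le1.
Qed.

(** The null lower envelope gives [y m] a mean of at most [8 * 2^-m]. Passing to the upper envelope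
    costs the same again, hence 16; the first-order condition adds 1 to 8, hence 9. *)
Lemma weights_of_near_minimizers : exists (n_ : nat -> nat) (h : nat -> T -> R),
  [/\ (forall k, (n_ k < n_ k.+1)%N), (forall m, measurable_fun setT (h m)),
   (forall m x, 0 <= h m x <= 1),
   (forall m, mean P (fun x => 1 - h m x) <= 16 * 2^-1 ^+ m) &
   (forall m k z, (m <= k)%N -> G (n_ k) z -> (forall x, z x <= (n_ k.+1)%:R) ->
     mean P (fun x => h m x * z x) <= 9 * 2^-1 ^+ k)].
Proof.
have [n_ [y [n_S Gy dy first_order]]] := rapid_near_minimizers.
have y01 k := G1_range _ _ (Gy k).
have my k := measurable_G _ _ (Gy k).1.
have n_ge k : (k <= n_ k)%N by elim: k => // k IH; exact: leq_ltn_trans (n_S k).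
(* To place the infimum from [m] on in [G n], compare it with [y (maxn m n)], whose level is at
   least [n]. *)
have lower0 m : mean P (lower_env y m) = 0.
  apply: mean_ae0; first exact: bounded_measurable_lower_env.
  apply: G_null => n; have nk : (n <= n_ (maxn m n))%N.
    exact: leq_trans (leq_maxr m n) (n_ge _).
  apply: (G_anti _ _ nk).
  apply: (G_solid _ _ _ (Gy _).1); first exact: measurable_lower_env.
  move=> x; have /andP[-> _] := lower_env01 _ y01 m x.
  by apply: ge_lower_env => //; exact: leq_maxl.
have ymean m : mean P (y m) <= 8 * 2^-1 ^+ m.
  apply: (le_trans (mean_lower_env_ge P y 4 my y01 _ dy m)) => //.
  by rewrite lower0; lra.
exists n_, (fun m x => 1 - upper_env y m x); split=> //.
- move=> m; apply: measurable_funB => //; exact: measurable_upper_env.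
- by move=> m x; have := upper_env01 _ y01 m x; lra.
- move=> m; rewrite (eq_mean P _ (upper_env y m)); last by move=> x; ring.
  have := mean_upper_env_le P y 4 my y01 _ dy m.
  by have := ymean m; lra.
- move=> m k z mk Gz zM.
  have bz := bounded_measurable_G _ _ _ Gz zM.
  (* Since [k >= m], the weight is at most [1 - y k], to which the first-order condition applies. *)
  apply: (@le_trans _ _ (mean P (fun x => (1 - y k x) * z x))); last first.
    by have := first_order k z Gz zM; have := ymean k; lra.
  apply: le_mean => [||x].
  + apply: bounded_measurableM => //; apply: bounded_measurableB => //.
    exact: bounded_measurable_upper_env.
  + apply: bounded_measurableM => //; apply: bounded_measurableB => //.
    exact: bounded_measurable_y.
  + rewrite ler_wpM2r ?(G_ge0 _ _ Gz)// lerD2l lerN2.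
    exact: le_upper_env.
Qed.

End NearMinimizers.

(** * Probabilities given by a density *)

Section DensityMeasure.
Context {d : measure_display} {T : measurableType d} {R : realType}
  (P : probability T R) (f : T -> R).
Hypothesis mf : measurable_fun setT f.
Hypothesis f0 : forall x, 0 <= f x.
Hypothesis f1 : (\int[P]_x (f x)%:E = 1)%E.

(** The properties of [f] are arguments so that the measure and probability structures, whose proofs
    rely on them, can be attached to this function. *)
Definition density_measure of measurable_fun setT f & (forall x, 0 <= f x) &
  (\int[P]_x (f x)%:E = 1)%E := fun A : set T => (\int[P]_(x in A) (f x)%:E)%E.

Local Notation Q := (density_measure mf f0 f1).

Let Q0 : Q set0 = 0%E. Proof. by rewrite /density_measure integral_set0. Qed.

Let Q_ge0 A : (0 <= Q A)%E.
Proof. by apply: integral_ge0 => x _; rewrite lee_fin. Qed.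

Let Q_sigma_additive : semi_sigma_additive Q.
Proof. by apply: semi_sigma_additive_nng_induced => [|x]; [exact/measurable_EFinP|rewrite lee_fin]. Qed.

HB.instance Definition _ := isMeasure.Build _ _ _ Q Q0 Q_ge0 Q_sigma_additive.

Let Q_setT : Q setT = 1%E. Proof. exact: f1. Qed.

HB.instance Definition _ := Measure_isProbability.Build _ _ _ Q Q_setT.

(** [Q] is absolutely continuous, and its Radon-Nikodym derivative has the same integral as [f] over
    every measurable set, so the two agree almost everywhere. *)
Lemma integral_density_measure (g : T -> \bar R) : (forall x, (0 <= g x)%E) ->
  measurable_fun setT g ->
  (\int[Q]_x g x = \int[P]_x (g x * (f x)%:E))%E.
Proof.
move=> g0 mg.
have QP : (Q : {finite_measure set T -> \bar R}) `<< P.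
  apply/null_content_dominatesP => A mA PA0.
  apply: null_set_integral => //; first exact/measurable_EFinP/measurable_funTS.
rewrite -(Radon_Nikodym_SigmaFinite.change_of_variables QP)//.
set r := Radon_Nikodym_SigmaFinite.f _ _.
have ir : P.-integrable setT r by exact: Radon_Nikodym_SigmaFinite.f_integrable.
have mr := measurable_int _ ir.
have rf : ae_eq P setT r (EFin \o f).
  apply: integral_ae_eq => //; first exact/measurable_EFinP.
  by move=> E _ mE; rewrite -Radon_Nikodym_SigmaFinite.f_integral.
apply: ae_eq_integral => //.
- exact: emeasurable_funM.
- by apply: emeasurable_funM => //; exact/measurable_EFinP.
- exact: ae_eqe_mul2l.
Qed.

Definition density_probability : probability T R := Q.

End DensityMeasure.

(** * Real-number facts: geometric decay and splitting a truncated excess *)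

Lemma exists_geometric_half_le {R : realType} (c e : R) : 0 < e ->
  exists m : nat, c * 2^-1 ^+ m <= e.
Proof.
move=> e0; have h1 : `|2^-1 : R| < 1 by rewrite gtr0_norm; lra.
have /cvgrPdist_le /(_ _ e0) [m _ /(_ m (leqnn m)) H] := cvg_geometric c h1.
exists m; move: H; rewrite sub0r normrN; exact/le_trans/ler_norm.
Qed.

(** The part of [u] between [a] and [c] is cut at [b]; the cases are the positions of [u] relative
    to [a], [b] and [c]. *)
Lemma min_pospart_split {R : realDomainType} (u a b c : R) : a <= b -> b <= c ->
  Num.min (Num.max (u - a) 0) (b - a) + Num.min (Num.max (u - b) 0) (c - b) =
  Num.min (Num.max (u - a) 0) (c - a).
Proof.
move=> ab bc.
have [ua|ua] := leP (u - a) 0.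
  rewrite (@max_r _ _ (u - b)); last lra.
  rewrite !min_l; lra.
have [ub|ub] := leP (u - b) 0.
  rewrite [Num.min 0 _]min_l; last lra.
  rewrite !min_l; lra.
rewrite min_r; last lra.
have [uc|uc] := leP u c.
  rewrite !min_l; lra.
rewrite !min_r; lra.
Qed.

(** * Excesses cut into layers, and the density built from the weights *)

Section EquivalentProbability.
Context {d : measure_display} {T : measurableType d} {R : realType}
  (P : probability T R).

Definition excess (X : T -> R) (n : nat) (x : T) : R := Num.max (X x - n%:R) 0.

Lemma excess_ge0 X n x : 0 <= excess X n x.
Proof. by rewrite /excess le_max lexx orbT. Qed.

Lemma measurable_excess X n : measurable_fun setT X ->
  measurable_fun setT (excess X n).
Proof.
by move=> mX; apply: measurable_maxr => //; exact: measurable_funB.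
Qed.

Variables (n_ : nat -> nat) (h : nat -> T -> R).
Hypothesis n_S : forall k, (n_ k < n_ k.+1)%N.
Hypothesis mh : forall m, measurable_fun setT (h m).
Hypothesis h01 : forall m x, 0 <= h m x <= 1.
Hypothesis h1 : forall m, mean P (fun x => 1 - h m x) <= 16 * 2^-1 ^+ m.

Let n_ge k : (k <= n_ k)%N.
Proof. by elim: k => // k IH; exact: leq_ltn_trans (n_S k). Qed.

Let n_mono m l : (m <= l)%N -> (n_ m <= n_ l)%N.
Proof. by move=> /subnKC <-; elim: (l - m)%N => [|j IH]; rewrite ?addn0// addnS (leq_trans IH)// ltnW. Qed.

(** The part of [X] between two consecutive levels; being at most [n_ k.+1], it is an admissible
    test function for the weights. *)
Definition excess_layer X k x : R :=
  Num.min (excess X (n_ k) x) ((n_ k.+1)%:R - (n_ k)%:R).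

Lemma sum_excess_layer X l j x : \sum_(0 <= i < j) excess_layer X (l + i) x =
  Num.min (excess X (n_ l) x) ((n_ (l + j))%:R - (n_ l)%:R).
Proof.
elim: j => [|j IH].
  by rewrite big_geq// addn0 subrr; apply/esym/min_idPr; exact: excess_ge0.
rewrite big_nat_recr//= IH /excess_layer /excess addnS.
have : (n_ (l + j))%:R <= (n_ (l + j).+1)%:R :> R by rewrite ler_nat ltnW.
have : (n_ l)%:R <= (n_ (l + j))%:R :> R by rewrite ler_nat n_mono// leq_addr.
by move=> *; exact: min_pospart_split.
Qed.

Lemma excess_le_sum_layers X l x :
  ((excess X (n_ l) x)%:E <= \sum_(i <oo) (excess_layer X (l + i) x)%:E)%E.
Proof.
(* At a given [x] finitely many layers suffice: [n_ (l + j)] is at least [j], which exceeds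
   [X x]. *)
pose j := (Num.truncn `|X x|).+1.
have layer0 i : 0 <= excess_layer X i x.
  by rewrite /excess_layer le_min excess_ge0 subr_ge0 ler_nat ltnW.
apply: (@le_trans _ _ (\sum_(0 <= i < j) (excess_layer X (l + i) x)%:E)%E); last first.
  by apply: nneseries_lim_ge => i _ _; rewrite lee_fin.
rewrite sumEFin lee_fin sum_excess_layer le_min lexx/= /excess ge_max.
rewrite subr_ge0 ler_nat n_mono ?leq_addr// andbT lerD2r.
have : X x < j%:R by rewrite (le_lt_trans (ler_norm _))// truncnS_gt.
move/ltW/le_trans; apply; rewrite ler_nat (leq_trans (leq_addl l j))//.
Qed.

Lemma measurable_excess_layer X k : measurable_fun setT X ->
  measurable_fun setT (excess_layer X k).
Proof. by move=> mX; apply: measurable_minr => //; exact: measurable_excess. Qed.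

Lemma excess_layer_range X k x :
  0 <= excess_layer X k x <= (n_ k.+1)%:R - (n_ k)%:R.
Proof.
rewrite /excess_layer ge_min lexx orbT le_min excess_ge0 subr_ge0 ler_nat.
by rewrite ltnW.
Qed.

Lemma bounded_measurable_h m : bounded_measurable (h m).
Proof. exact: bounded_measurable_range (mh m) (h01 m). Qed.

Variable X : T -> R.
Hypothesis mX : measurable_fun setT X.
Hypothesis h_layer : forall m k, (m <= k)%N ->
  mean P (fun x => h m x * excess_layer X k x) <= 9 * 2^-1 ^+ k.

Lemma measurable_weighted_excess (g : T -> R) n : measurable_fun setT g ->
  measurable_fun setT (fun x => (g x * excess X n x)%:E).
Proof.
by move=> mg; apply/measurable_EFinP/measurable_funM => //; exact: measurable_excess.
Qed.

(** Monotone convergence sums the layer bounds [9 * 2^-(l + i)] to [18 * 2^-l]; [m <= l] makes every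
    layer from [l] on admissible. *)
Lemma integral_h_excess_le m l : (m <= l)%N ->
  (\int[P]_x (h m x * excess X (n_ l) x)%:E <= (18 * 2^-1 ^+ l)%:E)%E.
Proof.
move=> ml; have bl i : bounded_measurable (excess_layer X i).
  exact: bounded_measurable_range (measurable_excess_layer _ _ mX) (excess_layer_range X i).
have bh i : bounded_measurable (fun x => h m x * excess_layer X i x).
  exact: bounded_measurableM (bounded_measurable_h m) (bl i).
have h0 i x : 0 <= h m x * excess_layer X i x.
  by have /andP[? _] := h01 m x; have /andP[? _] := excess_layer_range X i x; rewrite mulr_ge0.
apply: (@le_trans _ _ (\int[P]_x (\sum_(i <oo) (h m x * excess_layer X (l + i) x)%:E))%E).
  apply: ge0_le_integral => //=.
  - by move=> x _; rewrite lee_fin mulr_ge0 ?excess_ge0//; have /andP[] := h01 m x.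
  - exact: measurable_weighted_excess.
  - apply: ge0_emeasurable_sum; first by move=> j x _ _; rewrite lee_fin.
    by move=> j _; apply/measurable_EFinP; exact: (bh _).1.
  move=> x _; under eq_eseriesr do rewrite EFinM.
  rewrite nneseriesZl; last first.
    by move=> i _; rewrite lee_fin; have /andP[] := excess_layer_range X (l + i) x.
  rewrite EFinM lee_wpmul2l ?excess_le_sum_layers// lee_fin.
  by have /andP[] := h01 m x.
rewrite integral_nneseries//=.
- have -> : 18 * 2^-1 ^+ l = 9 * (2 * 2^-1 ^+ l) :> R by ring.
  apply: nneseries_half_geometric_le => // j.
    by apply: integral_ge0 => x _; rewrite lee_fin.
  by rewrite -EFin_mean// lee_fin h_layer// (leq_trans ml)// leq_addr.
- by move=> j; apply/measurable_EFinP; exact: (bh _).1.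
- by move=> j x _; rewrite lee_fin.
Qed.

(** The denominator absorbs the constant [n_ m] that appears for [m > l]. One factor [2^-m] makes
    the sum over [m] converge, the other is at most [2^-l] when [m > l]. *)
Definition weight m : R := (2^-1 ^+ m) ^+ 2 / (1 + (n_ m)%:R).

Lemma weight_gt0 m : 0 < weight m.
Proof. by rewrite divr_gt0 ?exprn_gt0// ltr_pwDl. Qed.

Lemma weightM m : weight m * (1 + (n_ m)%:R) = (2^-1 ^+ m) ^+ 2.
Proof. by rewrite /weight divfK// gt_eqF// ltr_pwDl. Qed.

Lemma half_gt0 m : 0 < 2^-1 ^+ m :> R. Proof. by rewrite exprn_gt0. Qed.

Lemma half_le1 m : 2^-1 ^+ m <= 1 :> R. Proof. by rewrite exprn_ile1//; lra. Qed.

Lemma weight_le m : weight m <= 2^-1 ^+ m.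
Proof.
have w0 := weight_gt0 m; have wM := weightM m; have n0 : 0 <= (n_ m)%:R :> R by [].
by have := half_gt0 m; have := half_le1 m; nra.
Qed.

Lemma weighted_h_range m x : 0 <= weight m * h m x <= 1.
Proof.
have /andP[h0 h1'] := h01 m x.
rewrite mulr_ge0 ?(ltW (weight_gt0 m))//=.
by rewrite mulr_ile1 ?(ltW (weight_gt0 m))// (le_trans (weight_le m))// half_le1.
Qed.

(* The excess over n_ l is at most n_ m plus the excess over n_ m, which
   handles the weights of index m > l. *)
Lemma weighted_integral_le m l :
  (\int[P]_x (weight m * h m x * excess X (n_ l) x)%:E <=
    (18 * 2^-1 ^+ l * 2^-1 ^+ m)%:E)%E.
Proof.
have w0 := weight_gt0 m.
have h0 x : 0 <= h m x by have /andP[] := h01 m x.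
have he0 n x : 0 <= h m x * excess X n x by rewrite mulr_ge0 ?excess_ge0.
under eq_integral do rewrite -mulrA EFinM.
rewrite ge0_integralZl//; last 3 first.
  - exact: measurable_weighted_excess.
  - by move=> x _; rewrite lee_fin.
  - by rewrite lee_fin ltW.
have [ml|lm] := leqP m l.
  apply: (@le_trans _ _ ((weight m)%:E * (18 * 2^-1 ^+ l)%:E)%E).
    by rewrite lee_wpmul2l ?lee_fin ?(ltW w0)//; exact: integral_h_excess_le.
  have c0 : 0 <= 18 * 2^-1 ^+ l :> R by rewrite mulr_ge0// ltW// half_gt0.
  by rewrite -EFinM lee_fin mulrC ler_wpM2l// weight_le.
apply: (@le_trans _ _ ((weight m)%:E * ((n_ m)%:R + 18 * 2^-1 ^+ m)%:E)%E).
  rewrite lee_wpmul2l ?lee_fin ?(ltW w0)//.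
  apply: (@le_trans _ _ (\int[P]_x ((n_ m)%:R%:E + (h m x * excess X (n_ m) x)%:E))%E).
    apply: ge0_le_integral => //=.
    - by move=> x _; rewrite lee_fin.
    - exact: measurable_weighted_excess.
    - by apply: emeasurable_funD => //; exact: measurable_weighted_excess.
    move=> x _; rewrite -EFinD lee_fin.
    have /andP[_ h1'] := h01 m x.
    have : h m x * excess X (n_ l) x <= h m x * ((n_ m)%:R + excess X (n_ m) x).
      rewrite ler_wpM2l// /excess ge_max; apply/andP; split.
        rewrite -lerBlDl le_max; apply/orP; left.
        have : 0 <= (n_ l)%:R :> R by []. lra.
      by rewrite addr_ge0// le_max lexx orbT.
    move/le_trans; apply; rewrite mulrDr lerD2r.
    by rewrite ler_piMl.
  rewrite ge0_integralD//=; last 2 first.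
    - by move=> x _; rewrite lee_fin.
    - exact: measurable_weighted_excess.
  rewrite (integral_cst P measurableT (n_ m)%:R%:E).
  rewrite [X in (_ * X + _)%E]probability_setT mule1 EFinD leeD2l//.
  exact: integral_h_excess_le.
rewrite -EFinM lee_fin.
have hm0 := half_gt0 m; have hm1 := half_le1 m; have hl0 := half_gt0 l.
apply: (@le_trans _ _ (18 * (weight m * (1 + (n_ m)%:R)))).
  rewrite mulrCA ler_pM2l//; have : 0 <= (n_ m)%:R :> R by []. lra.
rewrite weightM expr2 -!mulrA ler_wpM2l// ler_wpM2r ?(ltW hm0)//.
by apply: ler_wiXn2l; [lra|lra|exact: ltnW].
Qed.

(** The density of [Q] before normalization. The supremum stays in [0, 1] and is at most the sum of
    the weighted functions. *)
Definition sup_density := upper_env (fun m x => weight m * h m x) 0.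

Lemma measurable_weighted_h m : measurable_fun setT (fun x => weight m * h m x).
Proof. exact: measurable_funM. Qed.

Lemma measurable_sup_density : measurable_fun setT sup_density.
Proof. exact: measurable_upper_env measurable_weighted_h weighted_h_range 0%N. Qed.

Lemma sup_density01 x : 0 <= sup_density x <= 1.
Proof. exact: upper_env01 weighted_h_range 0%N x. Qed.

Lemma integral_sup_density_le l :
  (\int[P]_x (sup_density x * excess X (n_ l) x)%:E <= (36 * 2^-1 ^+ l)%:E)%E.
Proof.
have whe0 m x : 0 <= weight m * h m x * excess X (n_ l) x.
  by rewrite mulr_ge0 ?excess_ge0//; have /andP[] := weighted_h_range m x.
apply: (@le_trans _ _
    (\int[P]_x (\sum_(m <oo) (weight m * h m x * excess X (n_ l) x)%:E))%E).
  apply: ge0_le_integral => //=.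
  - move=> x _; rewrite lee_fin mulr_ge0 ?excess_ge0//.
    by have /andP[] := sup_density01 x.
  - exact/measurable_weighted_excess/measurable_sup_density.
  - apply: ge0_emeasurable_sum; first by move=> j x _ _; rewrite lee_fin.
    by move=> j _; exact/measurable_weighted_excess/measurable_weighted_h.
  move=> x _.
  have hk k : ((weight k * h k x * excess X (n_ l) x)%:E <=
      \sum_(m <oo) (weight m * h m x * excess X (n_ l) x)%:E)%E.
    apply: le_trans (nneseries_lim_ge k.+1 _) => [|m _ _]; last by rewrite lee_fin.
    rewrite big_nat_recr//= leeDr// sume_ge0// => m _.
    by rewrite lee_fin.
  move: hk; have : (0 <= \sum_(m <oo) (weight m * h m x * excess X (n_ l) x)%:E)%E.
    by apply: nneseries_ge0 => m _ _; rewrite lee_fin.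
  case: (\sum_(m <oo) _)%E => [b b0 hb||//]; last by move=> *; rewrite leey.
  rewrite lee_fin; rewrite lee_fin in b0.
  (* Where the series is finite and the excess positive, dividing by the excess turns the termwise
     bounds into one on the supremum. *)
  have := excess_ge0 X (n_ l) x; rewrite le_eqVlt => /predU1P[<-|e0].
    by rewrite mulr0.
  rewrite -ler_pdivlMr//; apply: upper_env_le => k _.
  by rewrite ler_pdivlMr// -lee_fin.
rewrite integral_nneseries//=.
- have -> : 36 * 2^-1 ^+ l = 18 * 2^-1 ^+ l * (2 * 2^-1 ^+ 0) :> R by rewrite expr0; ring.
  apply: nneseries_half_geometric_le => [|m|m].
  + by rewrite mulr_ge0// ltW// half_gt0.
  + by apply: integral_ge0 => x _; rewrite lee_fin.
  + exact: weighted_integral_le.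
- by move=> j; exact/measurable_weighted_excess/measurable_weighted_h.
- by move=> j x _; rewrite lee_fin.
Qed.

(** Where the supremum vanishes every [h m] is at most 0, so [1 - h m >= 1] there; that set has
    probability at most [16 * 2^-m] for all [m]. *)
Lemma sup_density_ae_gt0 : {ae P, forall x, 0 < sup_density x}.
Proof.
pose N := [set x | sup_density x <= 0].
have mN : measurable N.
  have -> : N = setT `&` sup_density @^-1` `]-oo, 0].
    by apply/seteqP; split=> x; rewrite /N /= in_itv/= => // -[].
  by apply: measurable_sup_density => //; exact: measurable_itv.
exists N; split=> //; last by move=> x /= /negP; rewrite -leNgt.
apply/eqP; rewrite eq_le measure_ge0 andbT.
apply/lee_addgt0Pr => e e0; rewrite add0e.
have [m me] := exists_geometric_half_le 16 e e0.
apply: (@le_trans _ _ (16 * 2^-1 ^+ m)%:E); last by rewrite lee_fin.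
apply: le_trans (_ : ((mean P (fun x => 1 - h m x))%:E <= _)%E); last by rewrite lee_fin.
have bh : bounded_measurable (fun x => 1 - h m x).
  exact/bounded_measurableB/bounded_measurable_h.
rewrite EFin_mean// -[N]setIT -integral_indic//.
apply: ge0_le_integral => //=.
- exact/measurable_EFinP.
- exact/measurable_EFinP/bh.1.
move=> x _; rewrite lee_fin indicE; case: (boolP (x \in N)) => /= [|_].
  rewrite inE /N /= => xN; have /andP[h0 _] := h01 m x.
  have wh : weight m * h m x <= 0.
    by apply: le_trans xN; exact: (le_upper_env _ weighted_h_range 0%N m x).
  have : h m x <= 0 by rewrite -(pmulr_rle0 _ (weight_gt0 m)).
  by lra.
by have /andP[_] := h01 m x; rewrite subr_ge0.
Qed.

End EquivalentProbability.

(** * Convexity of the convex hull *)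

Section ConvexHull.
Context {R : realType} {T : Type}.
Implicit Types (S : set (T -> R)) (Z : T -> R).

Lemma conv_hull_mem S Z : S Z -> conv_hull S Z.
Proof.
move=> SZ; exists 1%N, (fun=> 1), (fun=> Z); split=> //; first by rewrite big_ord1.
by apply/funext => x; rewrite big_ord1 mul1r.
Qed.

Lemma conv_hull_convex S Z1 Z2 (t : R) : conv_hull S Z1 -> conv_hull S Z2 ->
  0 <= t <= 1 -> conv_hull S (fun x => (1 - t) * Z1 x + t * Z2 x).
Proof.
move=> [k1 [c1 [f1 [c10 c11 Sf1 ->]]]] [k2 [c2 [f2 [c20 c21 Sf2 ->]]]] /andP[t0 t1].
(* Concatenate the two families, scaling their coefficients by [1 - t] and [t]. *)
exists (k1 + k2)%N, (fun i => match fintype.split i with inl j => (1 - t) * c1 j | inr j => t * c2 j end),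
  (fun i => match fintype.split i with inl j => f1 j | inr j => f2 j end); split.
- by move=> i; case: (fintype.split i) => j; rewrite mulr_ge0// subr_ge0.
- rewrite big_split_ord/=.
  under eq_bigr do rewrite (unsplitK (inl _)).
  under [X in _ + X]eq_bigr do rewrite (unsplitK (inr _)).
  by rewrite -!mulr_sumr c11 c21; ring.
- by move=> i; case: (fintype.split i) => j.
apply/funext => x; rewrite big_split_ord/= !mulr_sumr.
by congr (_ + _); apply: eq_bigr => i _; rewrite ?(unsplitK (inl _)) ?(unsplitK (inr _)) mulrA.
Qed.

End ConvexHull.

(** * Functions dominated by convex combinations of excesses *)

Section DominatedByConvexHull.
Context {d : measure_display} {T : measurableType d} {R : realType}.
Variable X : set (T -> R).

Definition excesses n : set (T -> R) := [set excess Xi n | Xi in X].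

Lemma conv_excessesP n Z : conv_hull (excesses n) Z ->
  exists (k : nat) (c : 'I_k -> R) (f : 'I_k -> T -> R),
    [/\ (forall i, 0 <= c i), \sum_(i < k) c i = 1, (forall i, X (f i))
      & Z = (fun x => \sum_(i < k) c i * excess (f i) n x)].
Proof.
move=> [k [c [f [c0 c1 Sf ->]]]].
have /choice[g hg] : forall i, exists Xi, X Xi /\ excess Xi n = f i.
  by move=> i; have [Xi XXi <-] := Sf i; exists Xi.
exists k, c, g; split=> //; first by move=> i; exact: (hg i).1.
by apply/funext => x; apply: eq_bigr => i _; rewrite -(hg i).2.
Qed.

Lemma conv_excesses_ge0 n Z x : conv_hull (excesses n) Z -> 0 <= Z x.
Proof.
move=> /conv_excessesP[k [c [f [c0 _ _ ->]]]].
by apply: sumr_ge0 => i _; rewrite mulr_ge0// excess_ge0.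
Qed.

(** Keep the members of [X] and the coefficients, and lower the level. *)
Lemma conv_excesses_anti m n Z : (m <= n)%N -> conv_hull (excesses n) Z ->
  exists2 Z', conv_hull (excesses m) Z' & forall x, Z x <= Z' x.
Proof.
move=> mn /conv_excessesP[k [c [f [c0 c1 Xf ->]]]].
exists (fun x => \sum_(i < k) c i * excess (f i) m x).
  by exists k, c, (fun i => excess (f i) m); split=> // i; exists (f i).
move=> x; apply: ler_sum => i _; rewrite ler_wpM2l// /excess.
rewrite ge_max !le_max lexx orbT andbT lerD2l lerN2 ler_nat.
by rewrite mn.
Qed.

(* Everywhere, rather than almost sure, inequalities: positive parts are
   nonnegative everywhere, so no null sets are needed here. *)
Definition dominated (n : nat) : set (T -> R) :=
  [set y : T -> R | [/\ measurable_fun setT y, (forall x, 0 <= y x) &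
    exists2 Z, conv_hull (excesses n) Z & forall x, y x <= Z x]].

Lemma dominated_0 n : X !=set0 -> dominated n (fun=> 0).
Proof.
move=> [X0 XX0]; split=> //; exists (excess X0 n); last by move=> x; exact: excess_ge0.
by apply: conv_hull_mem; exists X0.
Qed.

Lemma dominated_convex n (y z : T -> R) (t : R) : dominated n y -> dominated n z ->
  0 <= t <= 1 -> dominated n (fun x => (1 - t) * y x + t * z x).
Proof.
move=> [my y0 [Y cY yY]] [mz z0 [Z cZ zZ]] t01; have /andP[t0 t1] := t01; split.
- by apply: measurable_funD; exact: measurable_funM.
- by move=> x; rewrite addr_ge0// mulr_ge0// subr_ge0.
exists (fun x => (1 - t) * Y x + t * Z x); first exact: conv_hull_convex.
by move=> x; rewrite lerD// ler_wpM2l// subr_ge0.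
Qed.

Lemma dominated_anti m n : (m <= n)%N -> dominated n `<=` dominated m.
Proof.
move=> mn y [my y0 [Z cZ yZ]]; split=> //.
have [Z' cZ' ZZ'] := conv_excesses_anti _ _ _ mn cZ.
by exists Z' => // x; exact: le_trans (ZZ' x).
Qed.

Lemma dominated_solid n (y z : T -> R) : dominated n y -> measurable_fun setT z ->
  (forall x, 0 <= z x <= y x) -> dominated n z.
Proof.
move=> [my y0 [Z cZ yZ]] mz zy; split=> //; first by move=> x; have /andP[] := zy x.
by exists Z => // x; have /andP[_ zyx] := zy x; exact: le_trans (yZ x).
Qed.

Lemma dominated_excess n Xi : X Xi -> measurable_fun setT Xi -> dominated n (excess Xi n).
Proof.
move=> XXi mXi; split; [exact: measurable_excess|exact: excess_ge0|].
by exists (excess Xi n) => //; apply: conv_hull_mem; exists Xi.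
Qed.

Lemma dominated_O_n (P : probability T R) n : dominated n `<=` O_n P X n.
Proof.
move=> y [my y0 [Z cZ yZ]]; split; first by split=> //; exact: aeW.
by exists Z; split=> //; exact: aeW.
Qed.

End DominatedByConvexHull.

(** * Uniform integrability and the two implications *)

Section UniformIntegrability.
Context {d : measure_display} {T : measurableType d} {R : realType}.
Implicit Types (P Q : probability T R) (X : set (T -> R)).

Lemma equiv_prob_ae P Q (A : set T) : equiv_prob P Q ->
  {ae P, forall x, A x} <-> {ae Q, forall x, A x}.
Proof.
move=> PQ; split=> -[N [mN N0 AN]]; exists N; split=> //; exact/(PQ N mN).
Qed.

(** The supremum in the second condition of the theorem. It is extended-real, so its value on an
    empty class is [-oo] and not 0. *)
Definition tail_integral Q X n : \bar R := ereal_sup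
  [set (\int[Q]_x ((Xi x * \1_[set y | n%:R < Xi y] x)%:E))%E | Xi in X].

Lemma tail_ge0 (Xi : T -> R) n x : 0 <= Xi x * \1_[set y | n%:R < Xi y] x.
Proof.
rewrite indicE; case: (boolP (x \in _)) => /=; last by rewrite mulr0.
by rewrite inE/= mulr1 => /ltW; exact: le_trans.
Qed.

Lemma measurable_tail (Xi : T -> R) n : measurable_fun setT Xi ->
  measurable_fun setT (fun x => Xi x * \1_[set y | n%:R < Xi y] x).
Proof.
move=> mXi; apply: measurable_funM => //; apply: measurable_indic.
have -> : [set y | n%:R < Xi y] = setT `&` Xi @^-1` `]n%:R, +oo[.
  by apply/seteqP; split=> x /=; rewrite in_itv/= andbT => // -[].
by apply: mXi => //; exact: measurable_itv.
Qed.

Lemma excess_le_tail (Xi : T -> R) n x :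
  excess Xi n x <= Xi x * \1_[set y | n%:R < Xi y] x.
Proof.
rewrite /excess indicE; case: (boolP (x \in _)) => /=.
  rewrite inE/= mulr1 => nx; have n0 : 0 <= n%:R :> R by [].
  by rewrite ge_max; lra.
by rewrite notin_setE/= mulr0 => /negP; rewrite -leNgt ge_max subr_le0 lexx andbT.
Qed.

(** If [Xi x > n >= 2 m], then [m < Xi x / 2], so the excess over [m] is more than half of
    [Xi x]. *)
Lemma tail_le_excess (Xi : T -> R) m n x : (m.*2 <= n)%N ->
  Xi x * \1_[set y | n%:R < Xi y] x <= 2 * excess Xi m x.
Proof.
move=> mn; rewrite indicE; case: (boolP (x \in _)) => /=; last first.
  by rewrite mulr0 mulr_ge0// excess_ge0.
rewrite inE/= mulr1 => nx.
have : Xi x - m%:R <= excess Xi m x by rewrite le_max lexx.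
have : m.*2%:R <= n%:R :> R by rewrite ler_nat.
by rewrite -mul2n natrM; lra.
Qed.

Lemma tail_integral_ge0 Q X n : X !=set0 -> (0 <= tail_integral Q X n)%E.
Proof.
move=> [X0 XX0]; apply: (@le_trans _ _ (\int[Q]_x (X0 x * \1_[set y | n%:R < X0 y] x)%:E)%E).
  by apply: integral_ge0 => x _; rewrite lee_fin tail_ge0.
by apply: ereal_sup_ubound; exists X0.
Qed.

Lemma tail_integral_set0 Q n : tail_integral Q set0 n = -oo%E.
Proof. by rewrite /tail_integral image_set0 ereal_sup0. Qed.

Lemma dominated_of_O_n_null P X (hX : forall Xi, X Xi -> L0plus P Xi) Q :
  equiv_prob P Q -> tail_integral Q X @ \oo --> 0%E ->
  forall Y, (forall n, O_n P X n Y) -> {ae P, forall x, Y x = 0}.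
Proof.
move=> PQ tail0 Y OY.
have mY := (OY 0%N).1.1.
(* [Y] is nonnegative only almost surely; its positive part is so everywhere, as integrals of
   nonnegative functions require. *)
pose Yp x := Num.max (Y x) 0.
have mYp : measurable_fun setT Yp by exact: measurable_maxr.
have X0 : X !=set0.
  have [_ [Z [/conv_excessesP[k [c [f [_ c1 Xf _]]]] _]]] := OY 0%N.
  case: k c f c1 Xf => [c f|k c f _ Xf]; last by exists (f ord0).
  by rewrite big_ord0 => /esym/eqP; rewrite oner_eq0.
(* Each [(f i - n)_+] is at most the tail of [f i], and the coefficients sum to 1. *)
have Y_le_tail n : (\int[Q]_x (Yp x)%:E <= tail_integral Q X n)%E.
  have [_ [Z [cZ YZ]]] := OY n.
  have Z0 x := conv_excesses_ge0 X n Z x cZ.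
  have [k [c [f [c0 c1 Xf ZE]]]] := conv_excessesP X n Z cZ.
  have me i : measurable_fun setT (fun x => (excess (f i) n x)%:E).
    by apply/measurable_EFinP/measurable_excess; exact: (hX _ (Xf i)).1.
  have mce i : measurable_fun setT (fun x => (c i * excess (f i) n x)%:E).
    apply/measurable_EFinP/measurable_funM => //.
    by apply: measurable_excess; exact: (hX _ (Xf i)).1.
  have ce0 i x : 0 <= c i * excess (f i) n x by rewrite mulr_ge0// excess_ge0.
  apply: (@le_trans _ _ (\int[Q]_x (\sum_(i < k) (c i * excess (f i) n x)%:E))%E).
    apply: ae_ge0_le_integral => //.
    - by move=> x _; rewrite lee_fin le_max lexx orbT.
    - exact/measurable_EFinP.
    - by move=> x _; apply: sume_ge0 => i _; rewrite lee_fin.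
    - exact: emeasurable_sum.
    have /(equiv_prob_ae _ _ _ PQ) YZQ := YZ.
    apply: filterS YZQ => x /= YZx _; rewrite sumEFin lee_fin.
    by move: (Z0 x) YZx; rewrite ZE /Yp => Zx YZx; rewrite ge_max YZx.
  rewrite ge0_integral_sum//; last by move=> i x _; rewrite lee_fin.
  apply: (@le_trans _ _ (\sum_(i < k) (c i)%:E * tail_integral Q X n)%E).
    apply: lee_sum => i _; under eq_integral do rewrite EFinM.
    rewrite ge0_integralZl//; last 2 first.
      by move=> x _; rewrite lee_fin excess_ge0.
      by rewrite lee_fin.
    rewrite lee_wpmul2l ?lee_fin//.
    apply: (@le_trans _ _
        (\int[Q]_x ((f i x * \1_[set y | n%:R < f i y] x)%:E))%E).
      apply: ge0_le_integral => //.
      - by move=> x _; rewrite lee_fin excess_ge0.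
      - by apply/measurable_EFinP/measurable_tail; exact: (hX _ (Xf i)).1.
      - by move=> x _; rewrite lee_fin excess_le_tail.
    by apply: ereal_sup_ubound; exists (f i).
  rewrite -ge0_sume_distrl; last by move=> i _; rewrite lee_fin.
  by rewrite sumEFin c1 mul1e.
have Yp0 : (\int[Q]_x (Yp x)%:E = 0)%E.
  apply/eqP; rewrite eq_le integral_ge0 ?andbT; last first.
    by move=> x _; rewrite lee_fin le_max lexx orbT.
  apply: (cvge_to_ge tail0); exact: nearW.
have YpQ : {ae Q, forall x, Yp x = 0}.
  have : ae_eq Q setT (EFin \o Yp) (cst 0%E).
    apply/ae_eq_integral_abs => //; first exact/measurable_EFinP.
    rewrite -[RHS]Yp0; apply: eq_integral => x _ /=.
    by rewrite ger0_norm// le_max lexx orbT.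
  by apply: filterS => x /= /(_ I) [].
have /(equiv_prob_ae _ _ _ PQ) YpP := YpQ.
have Y0 := (OY 0%N).1.2.
apply: filterS2 Y0 YpP => x Yx0; rewrite /Yp => Ypx.
by apply/eqP; rewrite eq_le Yx0 -Ypx le_max lexx.
Qed.

Lemma cvge0_of_le (u : nat -> \bar R) : (forall n, 0 <= u n)%E ->
  (forall e : R, 0 < e -> exists N, forall n, (N <= n)%N -> (u n <= e%:E)%E) ->
  u @ \oo --> 0%E.
Proof.
move=> u0 ue; apply/fine_cvgP; split.
  have [N hN] := ue 1 ltr01; exists N => // n /= Nn.
  by rewrite ge0_fin_numE// (le_lt_trans (hN n Nn))// ltry.
apply/cvgrPdist_le => e e0; have [N hN] := ue e e0; exists N => // n /= Nn.
have un : (u n \is a fin_num) by rewrite ge0_fin_numE// (le_lt_trans (hN n Nn))// ltry.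
by rewrite sub0r normrN ger0_norm ?fine_ge0// -lee_fin fineK// hN.
Qed.

(** If [f] has integral 0 over [A], it vanishes almost everywhere on [A]; being almost everywhere
    positive, it forces [A] to be null. *)
Lemma equiv_density P (f : T -> R) (mf : measurable_fun setT f)
  (f0 : forall x, 0 <= f x) (f1 : (\int[P]_x (f x)%:E = 1)%E) :
  {ae P, forall x, 0 < f x} -> equiv_prob P (density_probability P f mf f0 f1).
Proof.
move=> fpos A mA.
rewrite /density_probability/= /density_measure; split=> [QA|PA]; last first.
  by apply: null_set_integral => //; exact/measurable_EFinP/measurable_funTS.
have h : ae_eq P A (EFin \o f) (cst 0%E).
  apply/ae_eq_integral_abs => //; first exact/measurable_EFinP/measurable_funTS.
  by rewrite -[RHS]QA; apply: eq_integral => x _ /=; rewrite ger0_norm.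
have : P.-negligible A.
  have : {ae P, forall x, ~ A x}.
    apply: filterS2 fpos h => x fx hx Ax.
    by have [fx0] := hx Ax; rewrite fx0 ltxx in fx.
  by apply: negligibleS => x Ax /=; apply; exact: contrapT.
by move/negligibleP; exact.
Qed.

(** The near-minimizer construction is applied to the classes [dominated X n], and the resulting
    density is normalized by its mean. *)
Lemma exists_equiv_prob P X (hX : forall Xi, X Xi -> L0plus P Xi) :
  X !=set0 ->
  (forall Y, (forall n, O_n P X n Y) -> {ae P, forall x, Y x = 0}) ->
  exists Q : probability T R, equiv_prob P Q /\ tail_integral Q X @ \oo --> 0%E.
Proof.
move=> X0 Onull.
have [|||||||n_ [h [n_S mh h01 h1 hG]]] := weights_of_near_minimizers P (dominated X).
- by move=> n y [].
- by move=> n y [].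
- by move=> n; exact: dominated_0.
- by move=> n y z t; exact: dominated_convex.
- exact: dominated_anti.
- by move=> n y z; exact: dominated_solid.
- by move=> y Gy; apply: Onull => n; exact/dominated_O_n/Gy.
have h_layer Xi m k : X Xi -> (m <= k)%N ->
    mean P (fun x => h m x * excess_layer n_ Xi k x) <= 9 * 2^-1 ^+ k.
  move=> XXi mk; have mXi := (hX _ XXi).1; apply: hG => //.
    apply: (dominated_solid X _ _ _ (dominated_excess X (n_ k) _ XXi mXi)).
      exact: measurable_excess_layer.
    move=> x; have /andP[-> _] := excess_layer_range n_ n_S Xi k x.
    by rewrite /excess_layer ge_min lexx.
  move=> x; have /andP[_ le] := excess_layer_range n_ n_S Xi k x.
  by apply: (le_trans le); rewrite lerBlDr lerDl.
pose Z := sup_density n_ h.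
have Z01 x : 0 <= Z x <= 1 by exact: sup_density01.
have mZ : measurable_fun setT Z by exact: measurable_sup_density.
have Zpos : {ae P, forall x, 0 < Z x} by exact: sup_density_ae_gt0.
have bZ : bounded_measurable Z by exact: bounded_measurable_range mZ Z01.
have Z0 x : 0 <= Z x by have /andP[] := Z01 x.
(* A zero mean would make [Z] vanish almost everywhere, against its almost sure positivity. *)
have meanZ_gt0 : 0 < mean P Z.
  rewrite lt_neqAle mean_ge0// andbT; apply/eqP => /esym meanZ0.
  have : ae_eq P setT (EFin \o Z) (cst 0%E).
    apply/ae_eq_integral_abs => //; first exact/measurable_EFinP.
    transitivity (mean P Z)%:E; last by rewrite meanZ0.
    by rewrite EFin_mean//; apply: eq_integral => x _ /=; rewrite ger0_norm.
  move=> Zae; have : {ae P, forall x, False}.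
    by apply: filterS2 Zpos Zae => x Zx /(_ I) [Zx0]; rewrite Zx0 ltxx in Zx.
  move=> [N [mN N0 hN]]; have : N = setT by apply/seteqP; split=> // x _; apply: hN => /=.
  by move=> NT; move: N0; rewrite NT probability_setT => /eqP; rewrite onee_eq0.
pose f x := (mean P Z)^-1 * Z x.
have c0 : 0 < (mean P Z)^-1 by rewrite invr_gt0.
have mf : measurable_fun setT f by exact: measurable_funM.
have f0 x : 0 <= f x by rewrite mulr_ge0// ltW.
have f1 : (\int[P]_x (f x)%:E = 1)%E.
  by rewrite -EFin_mean ?meanZ ?mulVf ?gt_eqF//; exact: bounded_measurableZ.
exists (density_probability P f mf f0 f1); split.
  by apply: equiv_density; apply: filterS Zpos => x Zx; rewrite mulr_gt0.
apply: cvge0_of_le => [n|e e0]; first exact: tail_integral_ge0.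
(* The factor 2 comes from [tail_le_excess], the inverse mean from normalization, 36 from
   [integral_sup_density_le]. *)
have [l hl] := exists_geometric_half_le (2 * (mean P Z)^-1 * 36) e e0.
(* Doubling the level lets the tail beyond [n] be compared with the excess over [n_ l]. *)
exists (n_ l).*2 => n ln; apply: ge_ereal_sup => _ [Xi XXi <-].
have mXi := (hX _ XXi).1.
have me := measurable_excess Xi (n_ l) mXi.
rewrite integral_density_measure; last 2 first.
  by move=> x; rewrite lee_fin tail_ge0.
  exact/measurable_EFinP/measurable_tail.
apply: (@le_trans _ _ (\int[P]_x ((2 * (mean P Z)^-1)%:E * (Z x * excess Xi (n_ l) x)%:E))%E).
  apply: ge0_le_integral => //.
  - by move=> x _; rewrite -EFinM lee_fin mulr_ge0// tail_ge0.
  - by apply: emeasurable_funM; apply/measurable_EFinP => //; exact: measurable_tail.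
  - by apply: emeasurable_funM => //; apply/measurable_EFinP/measurable_funM.
  move=> x _; rewrite -!EFinM lee_fin /f.
  have := tail_le_excess Xi (n_ l) n x ln.
  rewrite (_ : 2 * _ * _ = 2 * excess Xi (n_ l) x * ((mean P Z)^-1 * Z x)); last by ring.
  by move=> ?; rewrite ler_wpM2r// f0.
rewrite ge0_integralZl//; last 3 first.
- by apply/measurable_EFinP/measurable_funM.
- by move=> x _; rewrite lee_fin mulr_ge0// excess_ge0.
- by rewrite lee_fin mulr_ge0// ltW.
apply: (@le_trans _ _ ((2 * (mean P Z)^-1)%:E * (36 * 2^-1 ^+ l)%:E)%E).
  rewrite lee_wpmul2l ?lee_fin ?mulr_ge0 ?(ltW c0)//.
  by apply: integral_sup_density_le => // m k; exact: h_layer.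
by rewrite -EFinM lee_fin mulrA.
Qed.

End UniformIntegrability.

(** * Assembly of the two implications, with the empty class treated apart *)

Theorem theorem2p2 (d : measure_display) (T : measurableType d) (R : realType)
  (P : probability T R) (X : set (T -> R))
  (hX : forall Xi, X Xi -> L0plus P Xi) :
  (forall Y : T -> R,
     (forall n : nat, O_n P X n Y) <-> (measurable_fun setT Y /\ {ae P, forall x, Y x = 0}))
  <->
  (exists Q : probability T R, equiv_prob P Q /\
     (fun n : nat => ereal_sup
        [set (\int[Q]_x ((Xi x * \1_[set y | n%:R < Xi y] x)%:E))%E | Xi in X])
       @ \oo --> 0%E).
Proof.
split=> [inO|[Q [PQ tail0]] Y].
  apply: exists_equiv_prob => //; last by move=> Y /inO[].
  (* By hypothesis 0 lies in the class of level 0, so some convex combination exists; its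
     coefficients sum to 1, so it has a term and [X] is nonempty. *)
  have [_ [Z [/conv_excessesP[k [c [f [_ c1 Xf _]]]] _]]] :=
    (inO (fun=> 0)).2 (conj (measurable_cst _) (aeW _ (fun=> erefl))) 0%N.
  case: k c f c1 Xf => [c f|k c f _ Xf]; last by exists (f ord0).
  by rewrite big_ord0 => /esym/eqP; rewrite oner_eq0.
split=> [inO|[mY Y0] n].
  by split; [exact: (inO 0%N).1.1|exact: dominated_of_O_n_null hX _ PQ tail0 _ inO].
(* For an empty [X] the suprema are constantly [-oo] and cannot tend to 0. *)
have [XE|/set0P[X0 XX0]] := eqVneq X set0.
  have tE : tail_integral Q X = cst -oo%E.
    by apply/funext => m; rewrite XE tail_integral_set0.
  have : 0%E = -oo%E :> \bar R.
    have /cvg_lim <-// : tail_integral Q X @ \oo --> 0%E by [].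
    by rewrite tE lim_cst.
  by [].
split; first by split=> //; apply: filterS Y0 => x Yx; rewrite Yx.
exists (excess X0 n); split; first by apply: conv_hull_mem; exists X0.
by apply: filterS Y0 => x Yx; rewrite Yx excess_ge0.
Qed.
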